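(* Let $RR$ be a $Jf$-relative monad and $C(RR)$ the associated C-system. Put $Ob=Ob(C(RR))$ and $\widetilde{Ob}'=\coprod_{n\in\mathbb N}RR(n)$. Let $T',\widetilde T',S',\widetilde S',\delta'$ be the operations obtained from the operations $T,\widetilde T,S,\widetilde S,\delta$ of the C-system $C(RR)$ by transport along the identity of $Ob$ and the bijection $mb_{RR}:\widetilde{Ob}(C(RR))\to\widetilde{Ob}'$. Then: 1. $T'$ is defined on $\{\widehat m,\widehat n\in Ob\mid m>0\text{ and }n>m-1\}$ and is given by $T'(\widehat m,\widehat n)=\widehat{n+1}$. 2. $\widetilde T'$ is defined on $\{\widehat m\in Ob,(n,s)\in\widetilde{Ob}'\mid m>0\text{ and }n+1>m-1\}$ and is given by $\widetilde T'(\widehat m,(n,s))=(n+1,\partial_n^{m-1}(s))$. 3. $S'$ is defined on $\{(m,r)\in\widetilde{Ob}',\widehat n\in Ob\mid n>m+1\}$ and is given by $S'((m,r),\widehat n)=\widehat{n-1}$. 4. $\widetilde S'$ is defined on $\{(m,r)\in\widetilde{Ob}',(n,s)\in\widetilde{Ob}'\mid n>m\}$ and is given by $\widetilde S'((m,r),(n,s))=(n-1,\theta_{m,n}(r,s))$. 5. $\delta'$ is defined on $\{\widehat n\in Ob\mid n>0\}$ and is given by $\delta'(\widehat n)=(n,x_{n-1}^n)$.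
   Context: Composition is in diagrammatic order: $f\circ g$ means first $f$, then $g$. C-systems. A C0-system is a category $CC$ with a length function $l:Ob(CC)\to\mathbb N$, an object $pt$, a function $ft:Ob(CC)\to Ob(CC)$, morphisms $p_X:X\to ft(X)$, and, for $l(X)>0$ and $f:Y\to ft(X)$, an object $f^*(X)$ and a morphism $q(f,X):f^*(X)\to X$, such that: $l^{-1}(0)=\{pt\}$; $l(ft(X))=l(X)-1$ if $l(X)>0$; $ft(pt)=pt$; $pt$ is final; $l(f^*(X))>0$, $ft(f^*(X))=Y$ and $q(f,X)\circ p_X=p_{f^*(X)}\circ f$; $Id_{ft(X)}^*(X)=X$ and $q(Id_{ft(X)},X)=Id_X$; and for $g:Z\to Y$, $(g\circ f)^*(X)=g^*(f^*(X))$ and $q(g\circ f,X)=q(g,f^*(X))\circ q(f,X)$. A C-system is a C0-system with an operation assigning to each $f:Y\to X$ with $l(X)>0$ a morphism $s_f:Y\to(ft(f))^*(X)$, where $ft(f)=f\circ p_X$, such that $s_f\circ p_{(ft(f))^*(X)}=Id_Y$, $f=s_f\circ q(ft(f),X)$, and $s_f=s_{f\circ q(g,Z)}$ whenever $X=g^*(Z)$ with $g:ft(X)\to ft(Z)$. Such an operation is unique if it exists, and it exists iff all squares formed by $q(f,X),p_X,p_{f^*(X)},f$ are pull-backs. Write $\Gamma\le\Gamma'$ (''$\Gamma'$ is over $\Gamma$'') if $l(\Gamma)\le l(\Gamma')$ and $\Gamma=ft^{l(\Gamma')-l(\Gamma)}(\Gamma')$; $\Gamma<\Gamma'$ if moreover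 $l(\Gamma)<l(\Gamma')$. In that case $p_{\Gamma',\Gamma}:\Gamma'\to\Gamma$ is the composite of the $p$-morphisms. For $f:\Gamma\to ft^i(\Gamma')$, $l(\Gamma')\ge i$, define $f^*(\Gamma',0)=\Gamma$, $q(f,\Gamma',0)=f$, $f^*(\Gamma',i+1)=q(f,ft(\Gamma'),i)^*(\Gamma')$, $q(f,\Gamma',i+1)=q(q(f,ft(\Gamma'),i),\Gamma')$. If $\Gamma'\ge\Delta$ and $f:\Gamma\to\Delta$, write $f^*(\Gamma')$, $q(f,\Gamma')$ for these with $i=l(\Gamma')-l(\Delta)$. A morphism $a:\Gamma'\to\Gamma''$ of objects over $\Delta$ is over $\Delta$ if $a\circ p_{\Gamma'',\Delta}=p_{\Gamma',\Delta}$; then $f^*(a):f^*(\Gamma')\to f^*(\Gamma'')$ is the unique morphism over $\Gamma$ with $f^*(a)\circ q(f,\Gamma'')=q(f,\Gamma')\circ a$. $\widetilde{Ob}(CC)$ is the set of morphisms $s:ft(X)\to X$ with $l(X)>0$ and $s\circ p_X=Id_{ft(X)}$; for such $s$ put $\partial(s)=X$. Operations: $T(\Gamma,\Gamma')=p_\Gamma^*(\Gamma')\in Ob$ for $\Gamma,\Gamma'\in Ob$ with $l(\Gamma)>0$, $\Gamma'>ft(\Gamma)$; $\widetilde T(\Gamma,s)=p_\Gamma^*(s)\in\widetilde{Ob}$ for $\Gamma\in Ob$, $s\in\widetilde{Ob}$ with $l(\Gamma)>0$, $\partial(s)>ft(\Gamma)$; $S(r,\Gamma)=r^*(\Gamma)\in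 Ob$ for $r\in\widetilde{Ob}$, $\Gamma\in Ob$ with $\Gamma>\partial(r)$; $\widetilde S(r,s)=r^*(s)\in\widetilde{Ob}$ for $r,s\in\widetilde{Ob}$ with $\partial(s)>\partial(r)$; $\delta(\Gamma)=s_{Id_\Gamma}\in\widetilde{Ob}$ for $\Gamma\in Ob$ with $l(\Gamma)>0$. $Jf$-relative monads. $stn(n)=\{0,\dots,n-1\}$, $Fun(X,Y)$ is the set of functions $X\to Y$, $F(m,n)=Fun(stn(m),stn(n))$. A $Jf$-relative monad $RR$ consists of sets $RR(n)$ ($n\in\mathbb N$), functions $\eta(n):stn(n)\to RR(n)$, and for each $f\in RR(m,n):=Fun(stn(m),RR(n))$ a function $\rho(f):RR(m)\to RR(n)$, such that $\rho(\eta(n))=Id_{RR(n)}$, $\eta(m)\circ\rho(f)=f$ and $\rho(f)\circ\rho(g)=\rho(f\circ\rho(g))$ for $f\in RR(l,m)$, $g\in RR(m,n)$. Elements $f\in RR(m,n)$ are written as sequences $(f(0),\dots,f(m-1))$. The Kleisli category has objects $\mathbb N$, morphisms $m\to n$ the elements of $RR(m,n)$ (tagged by $m,n$), composition $f\circ_T g=f\circ\rho(g)$ and identities $\eta(m)$. For $f\in F(m,n)$ put $L(f)=f\circ\eta(n)\in RR(m,n)$ and, for $x\in RR(m)$, $f(x):=\rho(L(f))(x)$. Put $x_i^n=\eta(n)(i)\in RR(n)$. $\partial^i_n:stn(n)\to stn(n+1)$ ($0\le i\le n$) is the increasing injection omitting the value $i$; $\iota_n^i:stn(n)\to stn(n+i)$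 is $j\mapsto j$. For $f\in RR(n,m)$, $qq(f)=(\iota_m^1(f(0)),\dots,\iota_m^1(f(n-1)),x_m^{m+1})\in RR(n+1,m+1)$, and $qq^i$ is its $i$-fold iterate. For $n>m$, $\theta_{m,n}:RR(m)\times RR(n)\to RR(n-1)$ is $\theta_{m,n}(r,s)=\rho(qq^{n-m-1}(x_0^m,\dots,x_{m-1}^m,r))(s)$. The C-system $C(RR)$. Its underlying category is the opposite of the Kleisli category; the object $n$ is written $\widehat n$. So morphisms $\widehat m\to\widehat n$ are elements of $RR(n,m)$, and the composite of $f:\widehat l\to\widehat m$ and $g:\widehat m\to\widehat n$ is $f\circ_C g=g\circ_T f$. $l(\widehat n)=n$, $pt=\widehat 0$, $ft(\widehat{n+1})=\widehat n$, $ft(\widehat 0)=\widehat 0$, $p_{\widehat 0}=Id$, $p_{\widehat{n+1}}=L(\iota_n^1)=(x_0^{n+1},\dots,x_{n-1}^{n+1})$. For $f:\widehat m\to\widehat n$, $f^*(\widehat{n+1})=\widehat{m+1}$, and $q(f,\widehat{n+1}):\widehat{m+1}\to\widehat{n+1}$ is the unique morphism $q$ with $q\circ_C p_{\widehat{n+1}}=p_{\widehat{m+1}}\circ_C f$ and $q\circ_C(x_n^{n+1})=(x_m^{m+1})$, where $(x_n^{n+1}):\widehat{n+1}\to\widehat 1$ and $(x_m^{m+1}):\widehat{m+1}\to\widehat 1$. The bijection $mb_{RR}:\widetilde{Ob}(C(RR))\to\coprod_n RR(n)$ sends $s:\widehat n\to\widehat{n+1}$ to $(n,s(n))$; its inverse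 sends $(n,o)$ to $(x_0^n,\dots,x_{n-1}^n,o):\widehat n\to\widehat{n+1}$. *)

(* Defs.v *)
From mathcomp Require Import all_boot.
From Stdlib Require Import FunctionalExtensionality ProofIrrelevance.

Set Implicit Arguments.
Unset Strict Implicit.
Unset Printing Implicit Defensive.

Record category := Category {
  ob :> Type;
  hom : ob -> ob -> Type;
  idm : forall X, hom X X;
  mcomp : forall X Y Z, hom X Y -> hom Y Z -> hom X Z;
  comp1m : forall X Y (f : hom X Y), mcomp (idm X) f = f;
  compm1 : forall X Y (f : hom X Y), mcomp f (idm Y) = f;
  compA : forall X Y Z W (f : hom X Y) (g : hom Y Z) (h : hom Z W),
    mcomp (mcomp f g) h = mcomp f (mcomp g h) }.

Arguments hom {c} X Y.
Arguments idm {c} X.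
Arguments mcomp {c X Y Z} f g.

(* Diagrammatic order: first f, then g. So g ;; f below is the g o f of the
   C-system axioms, for g : Z -> Y and f : Y -> ft(X). *)
Notation "f ;; g" := (mcomp f g) (at level 50, left associativity).

Definition opcat (C : category) : category :=
  @Category C (fun X Y => hom Y X) (@idm C) (fun X Y Z f g => g ;; f)
    (fun X Y f => compm1 f) (fun X Y f => comp1m f)
    (fun X Y Z W f g h => esym (compA h g f)).

(* Equal objects are not convertible in general; [idmor e] is the identity
   regarded as a morphism between the two names of the same object. *)
Definition idmor (C : category) (X Y : C) (e : X = Y) : hom X Y :=
  match e in _ = Z return hom X Z with erefl => idm X end.

(* A morphism tagged by its domain and codomain. Equality of tagged morphisms
   is equality in the set of all morphisms, and includes the equality of the
   domains and of the codomains. *)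
Definition tagm (C : category) (X Y : C) (f : hom X Y) :
    {X : C & {Y : C & hom X Y}} :=
  existT _ X (existT _ Y f).

Record c0system := C0System {
  c0cat :> category;
  len : c0cat -> nat;
  pt : c0cat;
  ft : c0cat -> c0cat;
  pr : forall X, hom X (ft X);
  pb : forall X Y, 0 < len X -> hom Y (ft X) -> c0cat;
  pbq : forall X Y (h : 0 < len X) (f : hom Y (ft X)), hom (pb h f) X;
  len_eq0 : forall X, len X = 0 <-> X = pt;
  len_ft : forall X, 0 < len X -> len (ft X) = len X - 1;
  ft_pt : ft pt = pt;
  pt_final : forall X, exists f : hom X pt, forall g : hom X pt, g = f;
  len_pb : forall X Y (h : 0 < len X) (f : hom Y (ft X)), 0 < len (pb h f);
  ft_pb : forall X Y (h : 0 < len X) (f : hom Y (ft X)), ft (pb h f) = Y;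
  pbq_pr : forall X Y (h : 0 < len X) (f : hom Y (ft X)),
    pbq h f ;; pr X = pr (pb h f) ;; idmor (ft_pb h f) ;; f;
  (* Equality of tagged morphisms: Id^*(X) = X as well as q(Id, X) = Id_X. *)
  pbq_id : forall X (h : 0 < len X), tagm (pbq h (idm (ft X))) = tagm (idm X);
  (* (g o f)^*(X) = g^*(f^*(X)) as well as the equation for q(g o f, X). *)
  pbq_comp : forall X Y Z (h : 0 < len X) (f : hom Y (ft X)) (g : hom Z Y),
    tagm (pbq h (g ;; f)) =
    tagm (pbq (len_pb h f) (g ;; idmor (esym (ft_pb h f))) ;; pbq h f) }.

Arguments len {c} X.
Arguments pt {c}.
Arguments ft {c} X.
Arguments pr {c} X.
Arguments pb {c X Y} h f.
Arguments pbq {c X Y} h f.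

Record csystem := CSystem {
  cs0 :> c0system;
  sop : forall (X Y : cs0) (h : 0 < len X) (f : hom Y X),
    hom Y (pb h (f ;; pr X));
  sop_pr : forall X Y (h : 0 < len X) (f : hom Y X),
    sop h f ;; pr _ ;; idmor (ft_pb h (f ;; pr X)) = idm Y;
  sop_pbq : forall X Y (h : 0 < len X) (f : hom Y X),
    sop h f ;; pbq h (f ;; pr X) = f;
  (* Here the object X of the axiom is g^*(Z), so that W = ft(X). *)
  sop_pb : forall (Z W Y : cs0) (h : 0 < len Z) (g : hom W (ft Z))
      (f : hom Y (pb h g)),
    tagm (sop (len_pb h g) f) = tagm (sop h (f ;; pbq h g)) }.

Arguments sop {c X Y} h f.

Lemma idmor_id (C : category) (X : C) (e : X = X) : idmor e = idm X.
Proof. by rewrite (proof_irrelevance _ e erefl). Qed.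

Lemma idmor_comp (C : category) (X Y Z : C) (e : X = Y) (e' : Y = Z)
  (e'' : X = Z) : idmor e ;; idmor e' = idmor e''.
Proof. by subst; rewrite !idmor_id comp1m. Qed.

Lemma idmorK (C : category) (X Y : C) (e : X = Y) (e' : Y = X) :
  idmor e ;; idmor e' = idm X.
Proof. by rewrite (idmor_comp e e' erefl). Qed.

Lemma idmor_inj (C : category) (X Y Z : C) (e : Y = Z) (f g : hom X Y) :
  f ;; idmor e = g ;; idmor e -> f = g.
Proof. by subst; rewrite !compm1. Qed.

Lemma idmor_rot (C : category) (X Y : C) (e : X = Y) (f : hom Y X) :
  f ;; idmor e = idm Y -> idmor e ;; f = idm X.
Proof. by subst; rewrite comp1m compm1. Qed.

Lemma idmor_pr (C : c0system) (X Y : C) (e : X = Y) (e' : ft X = ft Y) :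
  idmor e ;; pr Y = pr X ;; idmor e'.
Proof. by subst; rewrite !idmor_id comp1m compm1. Qed.

Lemma tagm_inj (C : category) (X Y : C) (f g : hom X Y) :
  tagm f = tagm g -> f = g.
Proof.
move=> H.
have H1 := inj_pair2 _ _ _ _ _ H.
exact: inj_pair2 H1.
Qed.

Lemma tagm_src (C : category) (X X' Y : C) (f : hom X Y) (g : hom X' Y)
  (e : X = X') : tagm f = tagm g -> f = idmor e ;; g.
Proof. by subst=> /tagm_inj ->; rewrite comp1m. Qed.

Lemma pb_uniq (C : csystem) (X Y Z : C) (h : 0 < len X) (f : hom Y (ft X))
    (w1 w2 : hom Z (pb h f)) :
  w1 ;; pbq h f = w2 ;; pbq h f -> w1 ;; pr _ = w2 ;; pr _ -> w1 = w2.
Proof.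
move=> Hq Hp.
have E : tagm (sop (len_pb h f) w1) = tagm (sop (len_pb h f) w2).
  by rewrite !sop_pb Hq.
rewrite -(sop_pbq (len_pb h f) w1) -(sop_pbq (len_pb h f) w2).
move: E; move: (sop _ w1) (sop _ w2); rewrite Hp => a b Hab.
by rewrite (tagm_inj Hab).
Qed.

Lemma pb_lift_obj (C : c0system) (X Y Z : C) (h : 0 < len X)
    (f : hom Y (ft X)) (u : hom Z Y) (v : hom Z X) :
  u ;; f = v ;; pr X ->
  pb h (v ;; pr X) = pb (len_pb h f) (u ;; idmor (esym (ft_pb h f))).
Proof.
move=> <-; have H := pbq_comp h f u.
exact: (congr1 (fun t => projT1 t) H).
Qed.

Lemma pb_lift (C : csystem) (X Y Z : C) (h : 0 < len X) (f : hom Y (ft X))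
    (u : hom Z Y) (v : hom Z X) :
  u ;; f = v ;; pr X ->
  {w : hom Z (pb h f) | w ;; pr _ ;; idmor (ft_pb h f) = u /\
                        w ;; pbq h f = v}.
Proof.
move=> E.
exists (sop h v ;; idmor (pb_lift_obj h E) ;; pbq _ _).
have Eq : pbq h (v ;; pr X) = idmor (pb_lift_obj h E) ;;
   (pbq (len_pb h f) (u ;; idmor (esym (ft_pb h f))) ;; pbq h f).
  by apply: tagm_src; rewrite -pbq_comp E.
split; last by rewrite !compA -Eq sop_pbq.
rewrite !compA -(compA (pbq _ _)) pbq_pr !compA.
rewrite (idmorK (esym (ft_pb h f)) (ft_pb h f)) compm1.
have e1 : ft (pb h (v ;; pr X)) =
          ft (pb (len_pb h f) (u ;; idmor (esym (ft_pb h f)))).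
  by rewrite (pb_lift_obj h E).
rewrite -(compA (idmor (pb_lift_obj h E))) (idmor_pr _ e1) -!compA.
rewrite (compA _ (idmor e1)) (idmor_comp e1 _ (ft_pb h (v ;; pr X))).
by rewrite sop_pr comp1m.
Qed.

Fixpoint ftn (C : c0system) (i : nat) (X : C) : C :=
  if i is j.+1 then ftn j (ft X) else X.

Fixpoint prn (C : c0system) (i : nat) (X : C) : hom X (ftn i X) :=
  match i with
  | 0 => idm X
  | j.+1 => pr X ;; prn j (ft X)
  end.

Lemma leq_len_ft (C : c0system) (X : C) i : i < len X -> i <= len (ft X).
Proof. by move=> h; rewrite len_ft ?leq_subRL ?(leq_trans _ h). Qed.

(* f^*(X, i) together with q(f, X, i) : f^*(X, i) -> X, for f : G -> ft^i(X) *)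
Fixpoint pbqn (C : c0system) (G : C) (i : nat) :
    forall X : C, i <= len X -> hom G (ftn i X) -> {Y : C & hom Y X} :=
  match i with
  | 0 => fun X _ f => existT _ G f
  | j.+1 => fun X h f =>
      let f' := projT2 (pbqn (leq_len_ft h) f) in
      existT _ (pb (leq_trans (ltn0Sn j) h) f') (pbq _ f')
  end.

(* The larger object is the second argument: X is over D. *)
Definition is_over (C : c0system) (D X : C) : Prop :=
  len D <= len X /\ D = ftn (len X - len D) X.

Definition is_sover (C : c0system) (D X : C) : Prop :=
  is_over D X /\ len D < len X.

Definition prto (C : c0system) (D X : C) (h : is_over D X) : hom X D :=
  prn (len X - len D) X ;; idmor (esym (proj2 h)).

(* The hypothesis D = ft^i(X) is used to view f as a morphism to ft^i(X). *)
Definition bpb_sig (C : c0system) (G D X : C) (f : hom G D) (h : is_over D X) :=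
  pbqn (leq_subr (len D) (len X)) (f ;; idmor (proj2 h)).

(* f^*(X) and q(f, X) for f : G -> D and X over D *)
Definition bpb (C : c0system) (G D X : C) (f : hom G D) (h : is_over D X) : C :=
  projT1 (bpb_sig f h).

Definition bpbq (C : c0system) (G D X : C) (f : hom G D) (h : is_over D X) :
    hom (bpb f h) X :=
  projT2 (bpb_sig f h).

Definition mor_over (C : c0system) (D X Y : C) (hX : is_over D X) (hY : is_over D Y)
    (a : hom X Y) : Prop :=
  a ;; prto hY = prto hX.

Lemma len_pbS (C : c0system) (X Y : C) (h : 0 < len X) (f : hom Y (ft X)) :
  len (pb h f) = (len Y).+1.
Proof.
have /= := len_ft (len_pb h f); rewrite ft_pb => ->.
by rewrite subn1 prednK ?len_pb.
Qed.

Lemma len_pbqn (C : c0system) (G : C) i (X : C) (h : i <= len X)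
  (f : hom G (ftn i X)) : len (projT1 (pbqn h f)) = i + len G.
Proof. by elim: i X h f => [|i IH] X h f //=; rewrite len_pbS IH. Qed.

Lemma ftn_pbqn (C : c0system) (G : C) i (X : C) (h : i <= len X)
  (f : hom G (ftn i X)) : ftn i (projT1 (pbqn h f)) = G.
Proof. by elim: i X h f => [|i IH] X h f //=; rewrite ft_pb IH. Qed.

Lemma prn_obj (C : c0system) i (A B : C) (e : A = B) (e' : ftn i A = ftn i B) :
  idmor e ;; prn i B = prn i A ;; idmor e'.
Proof. by subst; rewrite !idmor_id comp1m compm1. Qed.

Lemma prn_num (C : c0system) i j (A B : C) (e : i = j) (e1 : ftn i A = B)
    (e2 : ftn j A = B) :
  prn i A ;; idmor e1 = prn j A ;; idmor e2.
Proof. by subst; rewrite (proof_irrelevance _ e2 erefl). Qed.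

(* One step of the projection f^*(X, i+1) -> f^*(ft X, i). *)
Lemma prn_pbqnS (C : c0system) (G : C) i (X : C) (h : i < len X)
    (f : hom G (ftn i (ft X))) (e : ftn i.+1 (projT1 (pbqn h f)) = G)
    (e' : ftn i (projT1 (pbqn (leq_len_ft h) f)) = G) :
  prn i.+1 (projT1 (pbqn h f)) ;; idmor e =
  pr _ ;; idmor (ft_pb _ _) ;; (prn i (projT1 (pbqn (leq_len_ft h) f)) ;;
    idmor e').
Proof.
rewrite /= !compA; congr (_ ;; _).
rewrite -compA.
set f' := projT2 _; set h0 := leq_trans _ _.
have e1 : ftn i (ft (pb h0 f')) = ftn i (projT1 (pbqn (leq_len_ft h) f)).
  by rewrite ft_pb.
by rewrite (prn_obj _ e1) compA (idmor_comp _ _ e).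
Qed.

Lemma pbqn_square (C : c0system) (G : C) i (X : C) (h : i <= len X)
    (f : hom G (ftn i X)) (e : ftn i (projT1 (pbqn h f)) = G) :
  projT2 (pbqn h f) ;; prn i X = prn i (projT1 (pbqn h f)) ;; idmor e ;; f.
Proof.
elim: i X h f e => [|i IH] X h f e.
  by rewrite /= compm1 comp1m idmor_id comp1m.
rewrite (prn_pbqnS _ (ftn_pbqn (leq_len_ft h) f)) !compA.
rewrite -(compA (prn i _)) -IH -!compA -pbq_pr /=.
by rewrite !compA.
Qed.

Lemma pbqn_uniq (C : csystem) (G : C) i (X Z : C) (h : i <= len X)
    (f : hom G (ftn i X)) (w1 w2 : hom Z (projT1 (pbqn h f))) :
  w1 ;; projT2 (pbqn h f) = w2 ;; projT2 (pbqn h f) ->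
  w1 ;; prn i _ = w2 ;; prn i _ -> w1 = w2.
Proof.
elim: i X h f w1 w2 => [|i IH] X h f w1 w2 Hq Hp.
  by move: Hp; rewrite !compm1.
apply: (pb_uniq Hq).
have H : w1 ;; pr _ ;; idmor (ft_pb _ _) = w2 ;; pr _ ;; idmor (ft_pb _ _).
  apply: IH.
    rewrite !compA -(compA (pr _)) -pbq_pr -!compA.
    by congr (_ ;; _).
  have := congr1 (fun g => g ;; idmor (ftn_pbqn h f)) Hp.
  rewrite 2!(compA _ (prn _ _)) (prn_pbqnS _ (ftn_pbqn (leq_len_ft h) f)).
  by rewrite -!compA => /idmor_inj.
exact: idmor_inj H.
Qed.

Lemma pbqn_lift (C : csystem) (G : C) i (X Z : C) (h : i <= len X)
    (f : hom G (ftn i X)) (u : hom Z G) (v : hom Z X)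
    (e : ftn i (projT1 (pbqn h f)) = G) :
  u ;; f = v ;; prn i X ->
  {w : hom Z (projT1 (pbqn h f)) |
     w ;; prn i _ ;; idmor e = u /\ w ;; projT2 (pbqn h f) = v}.
Proof.
elim: i X h f v e => [|i IH] X h f v e E.
  exists u; split; first by rewrite /= compm1 idmor_id compm1.
  by rewrite /= E /= compm1.
have [|w0 [Hu Hv]] := IH _ (leq_len_ft h) f (v ;; pr X) (ftn_pbqn _ _).
  by rewrite E /= compA.
have [w [H1 H2]] := pb_lift (leq_trans (ltn0Sn i) h) Hv.
exists w; split; last exact: H2.
by rewrite compA (prn_pbqnS _ (ftn_pbqn (leq_len_ft h) f)) -!compA H1.
Qed.

Lemma over_bpb (C : c0system) (G D X : C) (f : hom G D) (h : is_over D X) :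
  is_over G (bpb f h).
Proof.
rewrite /is_over /bpb /bpb_sig len_pbqn leq_addl addnK; split=> //.
by rewrite ftn_pbqn.
Qed.

Lemma prto_bpbE (C : c0system) (G D X : C) (f : hom G D) (h : is_over D X)
    (h' : is_over G (bpb f h))
    (e : ftn (len X - len D) (bpb f h) = G) :
  prto h' = prn (len X - len D) (bpb f h) ;; idmor e.
Proof. by apply: prn_num; rewrite /bpb /bpb_sig len_pbqn addnK. Qed.

Lemma bpbq_square (C : c0system) (G D X : C) (f : hom G D) (h : is_over D X) :
  bpbq f h ;; prto h = prto (over_bpb f h) ;; f.
Proof.
have e := ftn_pbqn (leq_subr (len D) (len X)) (f ;; idmor (proj2 h)).
rewrite (prto_bpbE _ e) /prto -compA.
rewrite (pbqn_square e) !compA.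
by rewrite (idmorK (proj2 h)) compm1.
Qed.

Lemma bpb_uniq (C : csystem) (G D X Z : C) (f : hom G D) (h : is_over D X)
    (w1 w2 : hom Z (bpb f h)) :
  w1 ;; bpbq f h = w2 ;; bpbq f h ->
  w1 ;; prto (over_bpb f h) = w2 ;; prto (over_bpb f h) -> w1 = w2.
Proof.
have e := ftn_pbqn (leq_subr (len D) (len X)) (f ;; idmor (proj2 h)).
rewrite (prto_bpbE _ e) => Hq Hp; apply: (pbqn_uniq Hq).
by move: Hp; rewrite -!compA => /idmor_inj.
Qed.

Lemma bpb_lift (C : csystem) (G D X Z : C) (f : hom G D) (h : is_over D X)
    (u : hom Z G) (v : hom Z X) :
  u ;; f = v ;; prto h ->
  {w : hom Z (bpb f h) | w ;; prto (over_bpb f h) = u /\ w ;; bpbq f h = v}.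
Proof.
move=> E.
have e := ftn_pbqn (leq_subr (len D) (len X)) (f ;; idmor (proj2 h)).
have E' : u ;; (f ;; idmor (proj2 h)) = v ;; prn (len X - len D) X.
  rewrite -compA E /prto !compA.
  by rewrite (idmorK _ (proj2 h)) compm1.
have [w [H1 H2]] := pbqn_lift e E'.
by exists w; split=> //; rewrite (prto_bpbE _ e) -compA.
Qed.

(* f^*(a) is specified by its defining property, together with a proof that
   it is the unique such morphism. *)
Lemma bpbm_sig (C : csystem) (G D X Y : C) (f : hom G D)
    (hX : is_over D X) (hY : is_over D Y) (a : hom X Y) (ha : mor_over hX hY a) :
  {b : hom (bpb f hX) (bpb f hY) |
    unique (fun b => mor_over (over_bpb f hX) (over_bpb f hY) b /\
                     b ;; bpbq f hY = bpbq f hX ;; a) b}.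
Proof.
have E : prto (over_bpb f hX) ;; f = (bpbq f hX ;; a) ;; prto hY.
  by rewrite -bpbq_square compA ha.
have [b [H1 H2]] := bpb_lift E.
exists b; split=> // b' [H1' H2'].
by apply: bpb_uniq; rewrite ?H2 ?H2' ?H1 ?H1'.
Qed.

Definition bpbm (C : csystem) (G D X Y : C) (f : hom G D)
    (hX : is_over D X) (hY : is_over D Y) (a : hom X Y) (ha : mor_over hX hY a) :
    hom (bpb f hX) (bpb f hY) :=
  sval (bpbm_sig f ha).

(* The set written \widetilde{Ob}(CC); [bd] is the boundary. *)
Record obt (C : csystem) := Obt {
  bd : C;
  sec : hom (ft bd) bd;
  len_bd : 0 < len bd;
  secK : sec ;; pr bd = idm (ft bd) }.

Lemma over_ft (C : c0system) (D X : C) : is_sover D X -> is_over D (ft X).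
Proof.
move=> [[h1 h2] h3]; split; first exact: leq_len_ft.
have h0 : 0 < len X by exact: leq_ltn_trans h3.
by rewrite {1}h2 len_ft // -subnAC subn1 -(@prednK (len X - len D)) ?subn_gt0.
Qed.

Lemma prto_ft (C : c0system) (D X : C) (h : is_sover D X) :
  prto (proj1 h) = pr X ;; prto (over_ft h).
Proof.
have [_ h3] := h.
have h0 : 0 < len X by exact: leq_ltn_trans h3.
have E : len X - len D = (len (ft X) - len D).+1.
  by rewrite len_ft // subnAC subn1 prednK ?subn_gt0.
have e : ftn (len (ft X) - len D).+1 X = D by rewrite -E -(proj2 (proj1 h)).
rewrite /prto (prn_num E _ e) /= compA; congr (_ ;; _).
exact: prn_num.
Qed.

Lemma sec_over (C : csystem) (D : C) (s : obt C) (h : is_sover D (bd s)) :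
  mor_over (over_ft h) (proj1 h) (sec s).
Proof. by rewrite /mor_over prto_ft -compA secK comp1m. Qed.

Lemma ft_pbqn (C : c0system) (G D X : C) (f : hom G D) n m (E : n = m.+1)
    (h : n <= len X) (h' : m <= len (ft X)) (e : D = ftn n X)
    (e' : D = ftn m (ft X)) :
  ft (projT1 (pbqn h (f ;; idmor e))) = projT1 (pbqn h' (f ;; idmor e')).
Proof.
subst n; rewrite /= ft_pb.
by rewrite (proof_irrelevance _ e e') (bool_irrelevance (leq_len_ft h) h').
Qed.

Lemma pbqn_pr (C : c0system) (G D X : C) (f : hom G D) n m (E : n = m.+1)
    (h : n <= len X) (h' : m <= len (ft X)) (e : D = ftn n X)
    (e' : D = ftn m (ft X)) :
  projT2 (pbqn h (f ;; idmor e)) ;; pr X =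
  pr _ ;; idmor (ft_pbqn f E h h' e e') ;; projT2 (pbqn h' (f ;; idmor e')).
Proof.
move: (ft_pbqn _ _ _ _ _ _); subst n => E1.
have Ee := proof_irrelevance _ e' e; subst e'.
have Eh := bool_irrelevance h' (leq_len_ft h); subst h'.
by rewrite /= pbq_pr (proof_irrelevance _ (ft_pb _ _) E1).
Qed.

Lemma subS_ft (C : c0system) (D X : C) (h : is_sover D X) :
  len X - len D = (len (ft X) - len D).+1.
Proof.
have [_ h3] := h.
have h0 : 0 < len X by exact: leq_ltn_trans h3.
by rewrite len_ft // subnAC subn1 prednK ?subn_gt0.
Qed.

Lemma ft_bpb (C : c0system) (G D X : C) (f : hom G D) (h : is_sover D X) :
  ft (bpb f (proj1 h)) = bpb f (over_ft h).
Proof. exact: (ft_pbqn f (subS_ft h)). Qed.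

Lemma bpbq_pr (C : c0system) (G D X : C) (f : hom G D) (h : is_sover D X) :
  bpbq f (proj1 h) ;; pr X =
  pr _ ;; idmor (ft_bpb f h) ;; bpbq f (over_ft h).
Proof.
rewrite /bpbq /bpb_sig (pbqn_pr f (subS_ft h) _
  (leq_subr _ _) _ (proj2 (over_ft h))).
by rewrite (proof_irrelevance _ (ft_pbqn _ _ _ _ _ _) (ft_bpb f h)).
Qed.

Lemma len_bpb_gt0 (C : c0system) (G D X : C) (f : hom G D) (h : is_sover D X) :
  0 < len (bpb f (proj1 h)).
Proof. by rewrite /bpb /bpb_sig len_pbqn addn_gt0 subn_gt0 (proj2 h). Qed.

Lemma prto_bpb_pr (C : c0system) (G D X : C) (f : hom G D) (h : is_sover D X) :
  prto (over_bpb f (proj1 h)) =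
  pr _ ;; idmor (ft_bpb f h) ;; prto (over_bpb f (over_ft h)).
Proof.
have hs : is_sover G (bpb f (proj1 h)).
  split; first exact: over_bpb.
  by rewrite /bpb /bpb_sig len_pbqn -addn1 addnC leq_add2r subn_gt0 (proj2 h).
rewrite (proof_irrelevance _ (over_bpb f (proj1 h)) (proj1 hs)).
rewrite prto_ft compA; congr (_ ;; _).
move: (over_ft hs) (over_bpb f (over_ft h)) (ft_bpb f h).
move: (ft _) => A; move: (bpb f (over_ft h)) => B h1 h2 e.
by subst; rewrite comp1m (proof_irrelevance _ h1 h2).
Qed.

Lemma bpbm_secK (C : csystem) (G D : C) (f : hom G D) (s : obt C)
    (h : is_sover D (bd s)) :
  idmor (ft_bpb f h) ;; bpbm f (sec_over h) ;; pr _ = idm _.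
Proof.
have [[H1 H2] _] := svalP (bpbm_sig f (sec_over h)).
rewrite -/(bpbm f (sec_over h)) in H1 H2.
rewrite compA; apply: idmor_rot.
apply: bpb_uniq.
  rewrite !compA -(compA (pr _)) -bpbq_pr -compA H2 compA secK.
  by rewrite comp1m compm1.
by rewrite !compA -(compA (pr _)) -prto_bpb_pr comp1m.
Qed.

(* f^*(s), as an element of [obt C], for f : G -> D and bd s > D *)
Definition obt_pb (C : csystem) (G D : C) (f : hom G D) (s : obt C)
    (h : is_sover D (bd s)) : obt C :=
  Obt (len_bpb_gt0 f h) (bpbm_secK f h).

Record pfun (A B : Type) := PFun {
  pdom : A -> Prop;
  papp : forall a, pdom a -> B }.

Arguments papp {A B} p {a} h.

Record bij (A B : Type) := Bij {
  bto : A -> B;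
  bfrom : B -> A;
  btoK : cancel bto bfrom;
  bfromK : cancel bfrom bto }.

Definition bij_id (A : Type) : bij A A :=
  @Bij A A id id (fun _ => erefl) (fun _ => erefl).

Lemma bij_prod_to (A B A' B' : Type) (f : bij A A') (g : bij B B') :
  cancel (fun u : A * B => (bto f u.1, bto g u.2))
         (fun v : A' * B' => (bfrom f v.1, bfrom g v.2)).
Proof. by case=> a b; rewrite /= !btoK. Qed.

Lemma bij_prod_from (A B A' B' : Type) (f : bij A A') (g : bij B B') :
  cancel (fun v : A' * B' => (bfrom f v.1, bfrom g v.2))
         (fun u : A * B => (bto f u.1, bto g u.2)).
Proof. by case=> a b; rewrite /= !bfromK. Qed.

Definition bij_prod (A B A' B' : Type) (f : bij A A') (g : bij B B') :
    bij (A * B) (A' * B') :=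
  Bij (bij_prod_to f g) (bij_prod_from f g).

Definition transport (A A' B B' : Type) (f : bij A A') (g : bij B B')
    (F : pfun A B) : pfun A' B' :=
  @PFun A' B' (fun a => pdom F (bfrom f a)) (fun a h => bto g (papp F h)).

Definition opT (C : csystem) : pfun (C * C) C :=
  @PFun _ _ (fun u => 0 < len u.1 /\ is_sover (ft u.1) u.2)
    (fun u h => bpb (pr u.1) (proj1 (proj2 h))).

Definition opTt (C : csystem) : pfun (C * obt C) (obt C) :=
  @PFun _ _ (fun u => 0 < len u.1 /\ is_sover (ft u.1) (bd u.2))
    (fun u h => obt_pb (pr u.1) (proj2 h)).

Definition opS (C : csystem) : pfun (obt C * C) C :=
  @PFun _ _ (fun u => is_sover (bd u.1) u.2)
    (fun u h => bpb (sec u.1) (proj1 h)).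

Definition opSt (C : csystem) : pfun (obt C * obt C) (obt C) :=
  @PFun _ _ (fun u => is_sover (bd u.1) (bd u.2))
    (fun u h => obt_pb (sec u.1) h).

Lemma delta_secK (C : csystem) (X : C) (h : 0 < len X) :
  idmor (ft_pb h (idm X ;; pr X)) ;; sop h (idm X) ;; pr _ = idm _.
Proof.
rewrite compA; apply: idmor_rot; exact: sop_pr.
Qed.

Definition opdelta (C : csystem) : pfun C (obt C) :=
  @PFun _ _ (fun X => 0 < len X)
    (fun X h => Obt (len_pb h _) (delta_secK h)).

(* A Jf-relative monad; stn(n) is 'I_n. *)

Record rmonad := RMonad {
  rr :> nat -> Type;
  eta : forall n, 'I_n -> rr n;
  rho : forall m n, ('I_m -> rr n) -> rr m -> rr n;
  rho_eta : forall n, rho (@eta n) = id;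
  eta_rho : forall m n (f : 'I_m -> rr n), rho f \o @eta m = f;
  rho_rho : forall l m n (f : 'I_l -> rr m) (g : 'I_m -> rr n),
    rho g \o rho f = rho (rho g \o f) }.

Arguments eta {r n} i.
Arguments rho {r m n} f x.

Lemma rho_etaE (RR : rmonad) n (x : RR n) : rho eta x = x.
Proof. by rewrite rho_eta. Qed.

Lemma eta_rhoE (RR : rmonad) m n (f : 'I_m -> RR n) i : rho f (eta i) = f i.
Proof. exact: (congr1 (fun g => g i) (eta_rho f)). Qed.

Lemma rho_rhoE (RR : rmonad) l m n (f : 'I_l -> RR m) (g : 'I_m -> RR n) x :
  rho g (rho f x) = rho (fun i => rho g (f i)) x.
Proof. exact: (congr1 (fun h => h x) (rho_rho f g)). Qed.

Definition kleisli (RR : rmonad) : category.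
Proof.
apply: (@Category nat (fun m n => 'I_m -> RR n) (fun n => @eta RR n)
  (fun l m n f g => rho g \o f)).
- by move=> m n f; rewrite eta_rho.
- by move=> m n f; rewrite rho_eta.
- by move=> k l m n f g h; rewrite -rho_rho.
Defined.

Definition Lmap (RR : rmonad) m n (f : 'I_m -> 'I_n) : 'I_m -> RR n :=
  eta \o f.

(* f(x) for f : stn(m) -> stn(n) and x in RR(m) *)
Definition rmap (RR : rmonad) m n (f : 'I_m -> 'I_n) (x : RR m) : RR n :=
  rho (Lmap RR f) x.

(* iota_n^1 *)
Definition iota1 n : 'I_n -> 'I_n.+1 := widen_ord (leqnSn n).

(* the sequence (f(0), ..., f(n-1), a) *)
Definition snoc (A : Type) n (f : 'I_n -> A) (a : A) : 'I_n.+1 -> A :=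
  fun i => if unlift ord_max i is Some j then f j else a.

Definition qq (RR : rmonad) n m (f : 'I_n -> RR m) : 'I_n.+1 -> RR m.+1 :=
  snoc (fun i => rmap (@iota1 m) (f i)) (eta ord_max).

Fixpoint qqn (RR : rmonad) i n m (f : 'I_n -> RR m) :
    'I_(i + n) -> RR (i + m) :=
  match i return 'I_(i + n) -> RR (i + m) with
  | 0 => f
  | j.+1 => qq (@qqn RR j n m f)
  end.

Arguments qqn {RR} i {n m} f.

Definition castr (RR : rmonad) m n (e : m = n) (x : RR m) : RR n :=
  ecast k (RR k) e x.

Lemma theta_dom m n : m < n -> (n - m - 1) + m.+1 = n.
Proof. by move=> h; rewrite subn1 addnS -addSn prednK ?subn_gt0 // subnK // ltnW. Qed.

Lemma theta_cod m n : m < n -> (n - m - 1) + m = n - 1.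
Proof.
by move=> h; apply: succn_inj; rewrite -addnS theta_dom // subn1 prednK // (leq_ltn_trans _ h).
Qed.

Definition theta (RR : rmonad) m n (h : m < n) (r : RR m) (s : RR n) :
    RR (n - 1) :=
  castr (theta_cod h)
    (rho (qqn (n - m - 1) (snoc eta r)) (castr (esym (theta_dom h)) s)).

Lemma snoc_last (A : Type) n (f : 'I_n -> A) (a : A) : snoc f a ord_max = a.
Proof. by rewrite /snoc unlift_none. Qed.

Lemma lift_max_iota1 n (i : 'I_n) : iota1 i = lift ord_max i.
Proof. by apply: val_inj; rewrite /= /bump leqNgt ltn_ord. Qed.

Lemma snoc_iota (A : Type) n (f : 'I_n -> A) (a : A) i :
  snoc f a (iota1 i) = f i.
Proof. by rewrite /snoc lift_max_iota1 liftK. Qed.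

Lemma snoc_ext (A : Type) n (f g : 'I_n.+1 -> A) :
  (forall i, f (iota1 i) = g (iota1 i)) -> f ord_max = g ord_max -> f = g.
Proof.
move=> H1 H2; apply: functional_extensionality => i.
by case: (unliftP ord_max i) => [j|] -> //; rewrite -lift_max_iota1.
Qed.

Definition ccat (RR : rmonad) : category := opcat (kleisli RR).

Notation chom RR m n := (@hom (ccat RR) m n).

Definition cp (RR : rmonad) (n : nat) : chom RR n n.-1 :=
  match n return chom RR n n.-1 with
  | 0 => @idm (ccat RR) 0
  | k.+1 => Lmap RR (@iota1 k)
  end.

Arguments cp RR n : clear implicits.

(* (x_n^{n+1}) *)
Definition clast (RR : rmonad) (n : nat) : chom RR n.+1 1 :=
  fun _ : 'I_1 => eta ord_max.

Arguments clast RR n : clear implicits.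

Definition cq_spec (RR : rmonad) (m n : nat) (f : chom RR m n)
    (q : chom RR m.+1 n.+1) : Prop :=
  q ;; cp RR n.+1 = cp RR m.+1 ;; f /\ q ;; clast RR n = clast RR m.

Lemma cq_sig (RR : rmonad) (m n : nat) (f : chom RR m n) :
  {q : chom RR m.+1 n.+1 | unique (cq_spec f) q}.
Proof.
exists (qq f); split.
  split; apply: functional_extensionality => i /=; rewrite eta_rhoE.
    by rewrite /qq snoc_iota.
  by rewrite /qq snoc_last.
move=> q [H1 H2]; apply: snoc_ext => [i|].
  by have := congr1 (fun g => g i) H1; rewrite /= eta_rhoE /qq snoc_iota => ->.
by have := congr1 (fun g => g ord0) H2; rewrite /= eta_rhoE /qq snoc_last => ->.
Qed.

(* q(f, n+1), as the unique morphism satisfying [cq_spec f] *)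
Definition cqS (RR : rmonad) (m n : nat) (f : chom RR m n) : chom RR m.+1 n.+1 :=
  sval (cq_sig f).

Definition cq (RR : rmonad) (n m : nat) :
    forall (h : 0 < n) (f : chom RR m n.-1), chom RR m.+1 n :=
  match n with
  | 0 => fun h _ => False_rect _ (notF h)
  | k.+1 => fun _ f => cqS f
  end.

Lemma cqSP (RR : rmonad) (m n : nat) (f : chom RR m n) : cq_spec f (cqS f).
Proof. by rewrite /cqS; case: (svalP (cq_sig f)). Qed.

Lemma cqS_uniq (RR : rmonad) (m n : nat) (f : chom RR m n) q :
  cq_spec f q -> cqS f = q.
Proof. by rewrite /cqS; case: (svalP (cq_sig f)) => _; apply. Qed.

Definition cc0 (RR : rmonad) : c0system.
Proof.
apply: (@C0System (ccat RR) (fun n : nat => n) (0 : nat) (fun n : nat => n.-1)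
  (cp RR) (fun (n m : nat) _ _ => m.+1) (fun (n m : nat) h f => cq h f)
  _ _ _ _ _ (fun _ _ _ _ => erefl)).
- by [].
- by move=> n h /=; rewrite subn1.
- by [].
- move=> n; have f0 : 'I_0 -> RR n by case.
  by exists f0 => g; apply: functional_extensionality; case.
- case=> // n m h f; have [H _] := cqSP f.
  by rewrite [cq _ _]/(cqS f) H compm1.
- case=> // n h; congr tagm; rewrite /=; apply: cqS_uniq.
  by split; rewrite ?comp1m ?compm1.
case=> // n m k h f g; congr tagm; rewrite [LHS]/(cqS (g ;; f)).
rewrite [cq _ f]/(cqS f) [cq _ _]/(cqS (g ;; idm _)) compm1.
apply: cqS_uniq; have [H1 H2] := cqSP f; have [H3 H4] := cqSP g.
by split; rewrite compA ?H1 ?H2 // -compA H3 compA.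
Defined.

(* For f : m -> n+1 in C(RR), i.e. a sequence of length n+1 in RR(m), the
   morphism s_f : m -> m+1 is (x_0, ..., x_{m-1}, f(n)). *)
Definition cs (RR : rmonad) (n m : nat) :
    forall (h : 0 < n) (f : chom RR m n), chom RR m m.+1 :=
  match n with
  | 0 => fun h _ => False_rect _ (notF h)
  | k.+1 => fun _ f => snoc eta (f ord_max)
  end.

Lemma cqS_iota (RR : rmonad) (m n : nat) (f : chom RR m n) i :
  cqS f (iota1 i) = rmap (@iota1 m) (f i).
Proof.
have [H _] := cqSP f.
by have := congr1 (fun g => g i) H; rewrite /= eta_rhoE.
Qed.

Lemma cqS_last (RR : rmonad) (m n : nat) (f : chom RR m n) :
  cqS f ord_max = eta ord_max.
Proof.
have [_ H] := cqSP f.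
by have := congr1 (fun g => g ord0) H; rewrite /= eta_rhoE.
Qed.

Definition csys (RR : rmonad) : csystem.
Proof.
apply: (@CSystem (cc0 RR) (fun (n m : nat) h f => cs h f)).
- case=> // n m h f; rewrite compm1.
  by apply: functional_extensionality => i /=; rewrite eta_rhoE snoc_iota.
- case=> // n m h f; apply: snoc_ext => [i|]; rewrite /=.
    rewrite cqS_iota /rmap rho_rhoE /= /Lmap eta_rhoE.
    rewrite -[RHS]rho_etaE; congr (rho _ _).
    by apply: functional_extensionality => j; rewrite /= eta_rhoE snoc_iota.
  by rewrite cqS_last eta_rhoE snoc_last.
case=> // n m k h g f; congr tagm.
by rewrite /= cqS_last eta_rhoE.
Defined.

(* The boundary of s has the form n+1; mb sends s to (n, s(n)). *)

Lemma last_dom n : 0 < n -> n - 1 < n.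
Proof. by case: n => // n _; rewrite subn1. Qed.

Definition last_ord n (h : 0 < n) : 'I_n := Ordinal (last_dom h).

Lemma mb_dom (RR : rmonad) (s : obt (csys RR)) : (bd s : nat).-1 < bd s.
Proof. by rewrite ltn_predL; exact: (len_bd s). Qed.

Definition mb_to (RR : rmonad) (s : obt (csys RR)) : {n : nat & RR n} :=
  existT RR (bd s : nat).-1
    ((sec s : 'I_(bd s) -> RR (bd s : nat).-1) (Ordinal (mb_dom s))).

Lemma mb_from_secK (RR : rmonad) n (o : RR n) :
  (snoc eta o : chom RR n n.+1) ;; cp RR n.+1 = idm (n : ccat RR).
Proof.
by apply: functional_extensionality => i; rewrite /= eta_rhoE snoc_iota.
Qed.

Definition mb_from (RR : rmonad) (u : {n : nat & RR n}) : obt (csys RR) :=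
  @Obt (csys RR) (projT1 u).+1 (snoc eta (projT2 u)) isT
    (mb_from_secK (projT2 u)).

Lemma mb_toK (RR : rmonad) : cancel (@mb_to RR) (@mb_from RR).
Proof.
case=> -[|n] // s h sK; rewrite /mb_to /mb_from /=.
set o := s _.
have E : snoc eta o = s.
  apply: snoc_ext => [i|].
    rewrite snoc_iota; have := congr1 (fun g => g i) sK.
    by rewrite /= eta_rhoE => ->.
  by rewrite snoc_last; congr (s _); apply: val_inj.
move: (mb_from_secK o); rewrite E => K.
by rewrite (bool_irrelevance h isT) (proof_irrelevance _ sK K).
Qed.

Lemma mb_fromK (RR : rmonad) : cancel (@mb_from RR) (@mb_to RR).
Proof.
case=> n o; rewrite /mb_to /=; congr (existT _ _ _).
by rewrite -[RHS](snoc_last eta o); congr (snoc _ _ _); apply: val_inj.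
Qed.

Definition mb (RR : rmonad) : bij (obt (csys RR)) {n : nat & RR n} :=
  Bij (@mb_toK RR) (@mb_fromK RR).

Definition idOb (RR : rmonad) : bij (csys RR) nat := bij_id nat.

Definition opT' (RR : rmonad) : pfun (nat * nat) nat :=
  transport (bij_prod (idOb RR) (idOb RR)) (idOb RR) (opT (csys RR)).

Definition opTt' (RR : rmonad) :
    pfun (nat * {n : nat & RR n}) {n : nat & RR n} :=
  transport (bij_prod (idOb RR) (mb RR)) (mb RR) (opTt (csys RR)).

Definition opS' (RR : rmonad) : pfun ({n : nat & RR n} * nat) nat :=
  transport (bij_prod (mb RR) (idOb RR)) (idOb RR) (opS (csys RR)).

Definition opSt' (RR : rmonad) :
    pfun ({n : nat & RR n} * {n : nat & RR n}) {n : nat & RR n} :=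
  transport (bij_prod (mb RR) (mb RR)) (mb RR) (opSt (csys RR)).

Definition opdelta' (RR : rmonad) : pfun nat {n : nat & RR n} :=
  transport (idOb RR) (mb RR) (opdelta (csys RR)).

(* \partial_n^i *)
Definition face n i (h : i < n.+1) : 'I_n -> 'I_n.+1 := lift (Ordinal h).

(* Main.v *)
Require Import Defs.
From mathcomp Require Import all_boot.
From Stdlib Require Import FunctionalExtensionality.

(** In C(RR) the objects are natural numbers, [ft] is the predecessor, and
    [is_over D X] only says [D <= X]; this gives all the domains, and the
    values of [T'] and [S'] follow by counting lengths.

    For the two operations on sections the point is that every canonical
    pullback square of C(RR) is given by the operation [qq]: iterating, the
    morphism q(f, i + D) along f : G -> D is [qqn i f] (lemmas [pbqn_csys] and
    [bpb_sig_csys]). The pullback f^*(s) of a section s of an object over D is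
    a section with f^*(s) ;; q(f, bd s) = q(f, ft (bd s)) ;; s.
    Reading off its last component, where q(f, bd s) takes as value the last
    variable, one finds that the element of RR representing f^*(s) is
    [rho (q(f, ft (bd s)))] of the element representing s. Hence in terms of
    [mb] the pullback acts by [rho (qqn i f)] (lemma [mb_obt_pb]).

    It remains to specialize f. For a projection f = L(iota^1) the iterate
    [qqn i f] is again L of a map of finite sets, namely of the injection
    omitting the value k (lemma [qqn_iota1]), and so gives the face map in
    [Tt']. For a section f = (x_0, ..., x_{m-1}, r) it is the substitution
    defining [theta]. Finally, [delta'] is computed directly, because the
    operation [sop] of C(RR) is explicit.

    The codomain of [qqn i f] is named i + G, which is in general not
    convertible to the name used in the theorem. Elements of RR are therefore
    compared as pairs [existT RR n x], for which such renamings are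
    invisible. *)

Lemma ftn_csys (RR : rmonad) i (n : csys RR) : ftn i n = n - i :> nat.
Proof. by elim: i n => [|i IH] n /=; rewrite ?subn0 // IH -subn1 -subnDA add1n. Qed.

Lemma is_over_csys (RR : rmonad) (D X : csys RR) :
  is_over D X <-> (D : nat) <= (X : nat).
Proof.
split=> [[] //|h]; split=> //.
by rewrite ftn_csys /= subKn.
Qed.

Lemma is_sover_csys (RR : rmonad) (D X : csys RR) :
  is_sover D X <-> (D : nat) < (X : nat).
Proof. by split=> [[] //|h]; split=> //; apply/is_over_csys/ltnW. Qed.

Lemma len_bpb {C : c0system} {G D X : C} (f : hom G D) (h : is_over D X) :
  len (bpb f h) = len X - len D + len G.
Proof. exact: len_pbqn. Qed.

Lemma cqSE (RR : rmonad) m n (f : chom RR m n) : cqS f = qq f.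
Proof.
by apply: snoc_ext => [i|]; rewrite ?cqS_iota ?cqS_last /qq ?snoc_iota ?snoc_last.
Qed.

(** Each step of the iterated pullback replaces the last morphism by [cqS] of
    it, and [cqS] is [qq]. The pair of object and morphism is compared as a
    whole, since the object is known only up to a provable equality when the
    induction hypothesis is used. *)
Lemma pbqn_csys (RR : rmonad) i (G D : csys RR) (f : hom G D)
    (h : i <= len ((i + D)%N : csys RR))
    (e : D = ftn i ((i + D)%N : csys RR)) :
  pbqn h (f ;; idmor e) =
  existT (fun Y : csys RR => hom Y ((i + D)%N : csys RR)) (i + G)%N (qqn i f).
Proof.
elim: i h e => [|i IH] h e.
  by rewrite idmor_id compm1.
have E := IH (leq_len_ft h) e.
by rewrite [LHS]/= E /= cqSE.
Qed.

(** The canonical pullback iterates [len X - len D] times; writing X as i + D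
    makes this number equal, though not convertible, to i. *)
Lemma bpb_sig_csys (RR : rmonad) i (G D : csys RR) (f : hom G D)
    (h : is_over D ((i + D)%N : csys RR)) :
  bpb_sig f h =
  existT (fun Y : csys RR => hom Y ((i + D)%N : csys RR)) (i + G)%N (qqn i f).
Proof.
rewrite /bpb_sig.
move: (leq_subr _ _) (proj2 h).
have -> : len ((i + D)%N : csys RR) - len D = i by exact: addnK.
exact: pbqn_csys.
Qed.

(** If X = n+1 is strictly over D, then the morphism q(f, X) is [qq] of something,
    so it takes the last variable to the last variable. The latter is an
    arbitrary [l] of maximal value because [bpb f h] need not be
    convertible to a successor. *)
Lemma bpbq_last_csys (RR : rmonad) (G D : csys RR) (n : nat) (f : hom G D)
    (h : is_over D (n.+1 : csys RR)) (l : 'I_(bpb f h)) :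
  (D : nat) <= n -> (l : nat).+1 = bpb f h ->
  (bpbq f h : 'I_n.+1 -> RR (bpb f h)) ord_max = eta l.
Proof.
move=> hD; have [i en] : exists i, n = i + D by exists (n - D); rewrite subnK.
subst n; move: l; rewrite /bpbq /bpb.
rewrite (@bpb_sig_csys RR i.+1 G D f h) /= => l [el].
by rewrite /qq snoc_last; congr eta; apply: val_inj.
Qed.

(** [obt_pb] corrects the domain of f^*(s) by some [idmor e], which [mb_to]
    does not see. *)
Lemma existT_idmor (RR : rmonad) (A B X : csys RR) (e : A = B) (b : hom B X)
    (o : 'I_X) :
  existT RR A ((idmor e ;; b : chom RR A X) o) =
  existT RR B ((b : chom RR B X) o).
Proof. by subst B; rewrite comp1m. Qed.

(** Pulling back a section along f substitutes q(f, ft (bd s)) in the element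
    of RR that represents it: this is the last component of the equation that
    defines f^*(s). *)
Lemma mb_obt_pb (RR : rmonad) i (G D : csys RR) (f : hom G D)
    (x : RR (i + D)%N)
    (h : is_sover D (bd (mb_from (existT RR (i + D)%N x)))) :
  mb_to (obt_pb f h) =
  existT RR (i + G)%N (rho (qqn i f) x).
Proof.
have [[_ H] _] := svalP (bpbm_sig f (sec_over h)).
rewrite -/(bpbm f (sec_over h)) in H.
rewrite /mb_to /= existT_idmor.
set o := Ordinal _.
have Ho : bpbq f (proj1 h) ord_max = eta o.
  apply: bpbq_last_csys; first exact: leq_addl.
  by rewrite /= prednK // (len_bpb_gt0 f h).
have := congr1 (fun g => g ord_max) H.
rewrite /= Ho eta_rhoE snoc_last => ->.
by rewrite /bpbq /bpb (@bpb_sig_csys RR i G D f (over_ft h)).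
Qed.

Lemma qq_Lmap (RR : rmonad) n m (f : 'I_n -> 'I_m) (g : 'I_n.+1 -> 'I_m.+1) :
  (forall j, g (iota1 j) = iota1 (f j)) -> g ord_max = ord_max ->
  qq (Lmap RR f) = Lmap RR g.
Proof.
move=> Hi Hl; apply: snoc_ext => [j|]; rewrite /qq ?snoc_iota ?snoc_last /Lmap /=.
  by rewrite /rmap eta_rhoE Hi.
by rewrite Hl.
Qed.

(** Extending the inclusion [iota1 k] by fixing i further variables, which are
    renumbered by one, gives the increasing injection that skips k. The cast
    identifies (i + k).+1 with i + k.+1. *)
Lemma qqn_iota1 (RR : rmonad) i k (h : k < (i + k).+1) :
  qqn i (Lmap RR (@iota1 k)) =
  Lmap RR (cast_ord (esym (addnS i k)) \o face h).
Proof.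
elim: i h => [|i IH] h.
  congr Lmap; apply: functional_extensionality => j; apply: val_inj => /=.
  by rewrite /bump leqNgt ltn_ord.
have h' : k < (i + k).+1 by rewrite ltnS leq_addl.
rewrite /= (IH h'); apply: qq_Lmap => [j|]; apply: val_inj => //=.
rewrite /bump leq_addl; exact: esym (addnS i k).
Qed.

Lemma existT_rmap_cast (RR : rmonad) m n n' (e : n = n') (g : 'I_m -> 'I_n)
    (s : RR m) :
  existT RR n' (rmap (cast_ord e \o g) s) = existT RR n (rmap g s).
Proof.
subst n'; congr (existT RR n _); congr rmap.
by apply: functional_extensionality => j; rewrite /= cast_ord_id.
Qed.

Lemma existT_castr (RR : rmonad) m n (e : m = n) (x : RR m) :
  existT RR n (castr e x) = existT RR m x.
Proof. by subst n. Qed.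

(** [theta] without the renamings that its definition needs for a general
    n > m: for n = i + m.+1 its exponent n - m - 1 is i. *)
Lemma existT_theta (RR : rmonad) m i (h : m < i + m.+1) (r : RR m)
    (s : RR (i + m.+1)) :
  existT RR (i + m.+1 - 1) (theta h r s) =
  existT RR (i + m) (rho (qqn i (snoc eta r)) s).
Proof.
rewrite /theta existT_castr; move: (theta_dom h).
have -> : i + m.+1 - m - 1 = i by rewrite -subnDA addn1 addnK.
by move=> e; rewrite (eq_irrelevance e erefl).
Qed.

Theorem theorem0p5p12 (RR : rmonad) :
  ((forall m n : nat, pdom (opT' RR) (m, n) <-> 0 < m /\ m - 1 < n) /\
   (forall (m n : nat) (h : pdom (opT' RR) (m, n)),
      papp (opT' RR) h = n.+1))
  /\
  ((forall (m n : nat) (s : RR n),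
      pdom (opTt' RR) (m, existT _ n s) <-> 0 < m /\ m - 1 < n.+1) /\
   (forall (m n : nat) (s : RR n) (h : pdom (opTt' RR) (m, existT _ n s))
      (hmn : m - 1 < n.+1),
      papp (opTt' RR) h = existT _ n.+1 (rmap (face hmn) s)))
  /\
  ((forall (m : nat) (r : RR m) (n : nat),
      pdom (opS' RR) (existT _ m r, n) <-> m.+1 < n) /\
   (forall (m : nat) (r : RR m) (n : nat)
      (h : pdom (opS' RR) (existT _ m r, n)),
      papp (opS' RR) h = n - 1))
  /\
  ((forall (m : nat) (r : RR m) (n : nat) (s : RR n),
      pdom (opSt' RR) (existT _ m r, existT _ n s) <-> m < n) /\
   (forall (m : nat) (r : RR m) (n : nat) (s : RR n)
      (h : pdom (opSt' RR) (existT _ m r, existT _ n s)) (hmn : m < n),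
      papp (opSt' RR) h = existT _ (n - 1) (theta hmn r s)))
  /\
  ((forall n : nat, pdom (opdelta' RR) n <-> 0 < n) /\
   (forall (n : nat) (h : pdom (opdelta' RR) n) (hn : 0 < n),
      papp (opdelta' RR) h = existT _ n (eta (last_ord hn)))).
Proof.
split; [|split; [|split; [|split]]]; split.
- move=> m n; split=> [[h1 /is_sover_csys h2]|[h1 h2]]; first by rewrite subn1.
  by split=> //; apply/is_sover_csys; move: h2; rewrite subn1.
- case=> [|k] n h; first by case: (h).
  have /is_sover_csys /= hk := proj2 h.
  have /= := len_bpb (pr (k.+1 : csys RR)) (proj1 (proj2 h)).
  by rewrite addnS subnK //; apply: ltnW.
- move=> m n s; split=> [[h1 /is_sover_csys h2]|[h1 h2]]; first by rewrite subn1.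
  by split=> //; apply/is_sover_csys; move: h2; rewrite subn1.
- case=> [|k] n s h; first by case: (h).
  (* Weakening by an object k.+1 is pullback along its projection to k. *)
  rewrite subn1 => /= hmn; have [i en] : exists i, n = i + k.
    by exists (n - k); rewrite subnK.
  subst n; rewrite [LHS](@mb_obt_pb RR i k.+1 k (Lmap RR (@iota1 k)) s).
  by rewrite qqn_iota1 -/(rmap _ _) existT_rmap_cast.
- by move=> m r n; split=> [/is_sover_csys|h] //; apply/is_sover_csys.
- move=> m r n h; have /is_sover_csys /= hn := h.
  have /= := len_bpb (sec (mb_from (existT RR m r))) (proj1 h).
  case: n h hn => // n h hn; rewrite subSS subn1 /= subnK => [//|].
  exact: ltnW.
- by move=> m r n s; split=> [/is_sover_csys|h] //; apply/is_sover_csys.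
- move=> m r n s h hmn; have [i en] : exists i, n = i + m.+1.
    by exists (n - m.+1); rewrite subnK.
  (* The section represented by r is snoc eta r, from m to m.+1. *)
  by subst n; rewrite existT_theta; apply: mb_obt_pb.
- by [].
case=> // n h hn.
rewrite [LHS]/= /mb_to /= rho_etaE; set o := Ordinal _.
have -> : o = ord_max by apply: val_inj.
rewrite snoc_last; congr (existT _ _ (eta _)); apply: val_inj.
by rewrite /= subn1.
Qed.
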